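(* Every Abelian pre-ordered group possesses a unique, up to an order isomorphism, almost Archimedeanization.
   Context: Groups are written additively with unit $0$. A subset $W$ of a group $X$ is a wedge if $0\in W$ and $W+W\subseteq W$; it is a cone if moreover $W\cap -W=\{0\}$. A pre-ordered group (POG) is a group $X$ together with a wedge $X_+$; write $x\le y$ iff $y-x\in X_+$. If $X_+$ is a cone, $X$ is an ordered group (OG). A POG $X$ is almost Archimedean if $y=0$ whenever there is $u\in X_+$ with $\pm ny\le u$ for all $n\in\mathbb N$. A group homomorphism $T:X\to Y$ between POGs is positive if $T(X_+)\subseteq Y_+$; an order isomorphism is a group isomorphism that is positive together with its inverse. Almost Archimedeanization: for a POG $X$, let $\mathcal C^a_{Arch_G}(X)$ be the category whose objects are pairs $\langle Y,\phi\rangle$ with $Y$ an almost Archimedean Abelian OG and $\phi:X\to Y$ a positive group homomorphism, and whose morphisms $\langle Y_1,\phi_1\rangle\to\langle Y_2,\phi_2\rangle$ are positive group homomorphisms $\psi:Y_1\to Y_2$ with $\psi\circ\phi_1=\phi_2$. If $\langle Y_0,\phi_0\rangle$ is an initial object of $\mathcal C^a_{Arch_G}(X)$, then the OG $Y_0$ is called an almost Archimedeanization of the POG $X$. *)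

(* Defs.v *)
From HB Require Import structures.
From mathcomp Require Import all_boot all_order all_algebra.
From mathcomp Require Import boolp classical_sets.

Set Implicit Arguments.
Unset Strict Implicit.
Unset Printing Implicit Defensive.

Import GRing.Theory.

Local Open Scope classical_set_scope.
Local Open Scope ring_scope.

Definition wedge (X : zmodType) (W : set X) : Prop :=
  W 0 /\ [set x + y | x in W & y in W] `<=` W.

Definition cone (X : zmodType) (W : set X) : Prop :=
  wedge W /\ W `&` [set - x | x in W] = [set 0].

(* Commutativity comes from zmodType: these are the Abelian pre-ordered groups. *)
Record pog := Pog {
  pog_group :> zmodType;
  pog_pos : set pog_group;
  pog_wedge : wedge pog_pos }.

Definition pog_le (X : pog) (x y : X) : Prop := pog_pos (y - x).

Definition ordered_group (X : pog) : Prop := cone (@pog_pos X).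

Definition almost_archimedean (X : pog) : Prop :=
  forall y : X,
    (exists2 u : X, pog_pos u &
       forall n : nat, pog_le (y *+ n) u /\ pog_le (- (y *+ n)) u) ->
    y = 0.

Definition positive (X Y : pog) (T : X -> Y) : Prop :=
  T @` @pog_pos X `<=` @pog_pos Y.

Record pos_hom (X Y : pog) := PosHom {
  pos_hom_fun :> {additive X -> Y};
  pos_hom_pos : positive pos_hom_fun }.

Definition order_isomorphic (X Y : pog) : Prop :=
  exists (f : pos_hom X Y) (g : pos_hom Y X), cancel f g /\ cancel g f.

Record aarch_obj (X : pog) := AArchObj {
  aarch_pog : pog;
  aarch_ordered : ordered_group aarch_pog;
  aarch_almost_archimedean : almost_archimedean aarch_pog;
  aarch_map : pos_hom X aarch_pog }.

Record aarch_hom (X : pog) (A B : aarch_obj X) := AArchHom {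
  aarch_hom_fun :> pos_hom (aarch_pog A) (aarch_pog B);
  aarch_hom_comm : aarch_hom_fun \o aarch_map A =1 aarch_map B }.

(* Morphisms are compared as functions, not as records carrying proofs. *)
Definition initial (X : pog) (A : aarch_obj X) : Prop :=
  forall B : aarch_obj X,
    exists f : aarch_hom A B, forall g : aarch_hom A B, g =1 f.

Definition almost_archimedeanization (X Y : pog) : Prop :=
  exists (oY : ordered_group Y) (aY : almost_archimedean Y) (phi : pos_hom X Y),
    initial (AArchObj oY aY phi).

(* Main.v *)
Require Import Defs.
From HB Require Import structures.
From mathcomp Require Import all_boot all_order all_algebra.
From mathcomp Require Import boolp classical_sets.

(** Call an element of a pre-ordered group X null when every positive
    homomorphism from X to an almost Archimedean ordered group kills it.  The
    null elements form a subgroup N, and the almost Archimedeanization is X / N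
    ordered by the image of the positive wedge of X.

    By the very choice of N, every positive homomorphism from X to an almost
    Archimedean ordered group factors through X / N ([null_quot_lift]); the
    factor is positive because positive elements of the quotient are images of
    positive elements of X, and unique because the projection is surjective.
    So only membership of X / N in the category is at stake.  The factors
    jointly separate the points of X / N, so X / N has no null element but 0
    ([null_quot_separated]).  Both the antisymmetry of the order and the almost
    Archimedean property say that certain inequalities force an element to be
    0; positive homomorphisms preserve these inequalities, so such an element
    is null, hence 0 ([separated_ordered_group],
    [separated_almost_archimedean]).

    Uniqueness is that of initial objects: the mediating morphisms in the two
    directions compose to endomorphisms, which are identities
    ([initial_order_isomorphic]). *)

Set Implicit Arguments.
Unset Strict Implicit.
Unset Printing Implicit Defensive.

Import GRing.Theory.

Local Open Scope classical_set_scope.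
Local Open Scope ring_scope.
Local Open Scope quotient_scope.

(** * Positive homomorphisms *)

Lemma pos_homP (X Y : pog) (f : pos_hom X Y) (x : X) :
  pog_pos x -> pog_pos (f x).
Proof. by move=> x_ge0; apply: (@pos_hom_pos _ _ f); exists x. Qed.

Lemma pos_hom_le (X Y : pog) (f : pos_hom X Y) (x y : X) :
  pog_le x y -> pog_le (f x) (f y).
Proof. by rewrite /pog_le -raddfB; exact: pos_homP. Qed.

Lemma id_positive (X : pog) : positive (idfun : X -> X).
Proof. by move=> _ [x x_ge0 <-]. Qed.

Definition pos_hom_id (X : pog) : pos_hom X X :=
  @PosHom X X (idfun : {additive X -> X}) (@id_positive X).

Lemma comp_positive (X Y Z : pog) (g : pos_hom Y Z) (f : pos_hom X Y) :
  positive (g \o f).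
Proof. by move=> _ [x x_ge0 <-]; do 2!apply: pos_homP. Qed.

Definition pos_hom_comp (X Y Z : pog) (g : pos_hom Y Z) (f : pos_hom X Y) :
    pos_hom X Z :=
  @PosHom X Z (g \o f : {additive X -> Z}) (@comp_positive _ _ _ g f).

(** * Null elements *)

(** The quantifier over all objects is harmless because Prop is impredicative:
    this is a subset of X, and the quotient by it stays in the universe of X. *)
Definition null (X : pog) : {pred X} :=
  fun x => `[< forall B : aarch_obj X, aarch_map B x = 0 >].
Arguments null : clear implicits.

Lemma nullP (X : pog) (x : X) :
  reflect (forall B : aarch_obj X, aarch_map B x = 0) (x \in null X).
Proof. exact: asboolP. Qed.

Lemma null_zmod_closed (X : pog) : zmod_closed (null X).
Proof.
split=> [|x y /nullP x0 /nullP y0]; apply/nullP => B; first by rewrite raddf0.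
by rewrite raddfB x0 y0 subrr.
Qed.

HB.instance Definition _ (X : pog) :=
  GRing.isZmodClosed.Build X (null X) (null_zmod_closed X).

Definition separated (X : pog) : Prop := forall x : X, x \in null X -> x = 0.

(** If x and - x are positive then so are their images in any ordered group,
    where antisymmetry makes the image of x vanish. *)
Lemma separated_ordered_group (X : pog) : separated X -> ordered_group X.
Proof.
move=> sepX; split; first exact: pog_wedge.
rewrite eqEsubset; split=> [x [x_ge0 [y y_ge0 yx]]|_ ->].
  apply/sepX/nullP => B; case: (aarch_ordered B) => _ antisym.
  suff: [set 0] (aarch_map B x) by [].
  rewrite -antisym; split; first exact: pos_homP.
  by exists (aarch_map B y); [exact: pos_homP | rewrite -raddfN yx].
have [pos0 _] := pog_wedge X.
by split=> //; exists 0; rewrite ?oppr0.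
Qed.

(** The bounds +/- n y <= u are preserved by positive homomorphisms. *)
Lemma separated_almost_archimedean (X : pog) :
  separated X -> almost_archimedean X.
Proof.
move=> sepX y [u u_ge0 y_le]; apply/sepX/nullP => B.
apply: (@aarch_almost_archimedean _ B).
exists (aarch_map B u) => [|n]; first exact: pos_homP.
have [yn_le yNn_le] := y_le n.
by rewrite -raddfMn -raddfN; split; apply: pos_hom_le.
Qed.

(** * The quotient by the null elements *)

Section NullQuotient.
Variable X : pog.

Local Notation Q := (Quotient.quot (null X)).

Lemma null_quot_wedge : wedge ((\pi_Q : X -> Q) @` @pog_pos X).
Proof.
have [pos0 posD] := pog_wedge X; split; first by exists 0; rewrite ?pi_zeror.
move=> _ [_ [x x_ge0 <-] [_ [y y_ge0 <-] <-]]; exists (x + y).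
  by apply: posD; exists x => //; exists y.
by rewrite pi_addr.
Qed.

Definition null_quot : pog := Pog null_quot_wedge.

Lemma null_pi_zmod_morphism : zmod_morphism (\pi_Q : X -> null_quot).
Proof. by move=> x y /=; rewrite pi_addr pi_oppr. Qed.

Definition null_pi (x : X) : null_quot := \pi_Q x.

HB.instance Definition _ :=
  GRing.isZmodMorphism.Build X null_quot null_pi null_pi_zmod_morphism.

Lemma null_pi_positive : positive null_pi.
Proof. by []. Qed.

Definition null_proj : pos_hom X null_quot :=
  @PosHom X null_quot null_pi null_pi_positive.

Lemma null_proj_surj (q : null_quot) : exists x, null_proj x = q.
Proof. by exists (repr (q : Q)); exact: reprK. Qed.

Section Lift.
Variable B : aarch_obj X.

Definition null_lift (q : null_quot) : aarch_pog B :=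
  aarch_map B (repr (q : Q)).

(** The element x and the chosen representative of its class differ by a null
    element, on which aarch_map B vanishes. *)
Lemma null_lift_proj (x : X) : null_lift (null_proj x) = aarch_map B x.
Proof.
apply/eqP; rewrite -subr_eq0 -raddfB; apply/eqP; move: B; apply/nullP.
by rewrite Quotient.idealrBE reprK.
Qed.

Lemma null_lift_zmod_morphism : zmod_morphism null_lift.
Proof.
move=> p q; have [x <-] := null_proj_surj p; have [y <-] := null_proj_surj q.
by rewrite -raddfB !null_lift_proj raddfB.
Qed.

HB.instance Definition _ :=
  GRing.isZmodMorphism.Build null_quot (aarch_pog B) null_lift
    null_lift_zmod_morphism.

Lemma null_lift_positive : positive null_lift.
Proof.
move=> _ [_ [x x_ge0 <-] <-].
by rewrite [null_lift _]null_lift_proj; exact: pos_homP.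
Qed.

Definition null_quot_lift : pos_hom null_quot (aarch_pog B) :=
  @PosHom null_quot (aarch_pog B) null_lift null_lift_positive.

End Lift.

(** The lift of each positive homomorphism on X is one of those that a null
    class must be killed by, so its representatives are null in X. *)
Lemma null_quot_separated : separated null_quot.
Proof.
move=> q; have [x <-] := null_proj_surj q => /nullP q0.
suff /eqP: \pi_Q x == \pi_Q 0 by rewrite pi_zeror.
rewrite -Quotient.idealrBE subr0; apply/nullP => B.
rewrite -null_lift_proj.
exact: (q0 (AArchObj (@aarch_ordered _ B) (@aarch_almost_archimedean _ B)
              (null_quot_lift B))).
Qed.

Lemma null_quot_almost_archimedeanization :
  almost_archimedeanization X null_quot.
Proof.
exists (separated_ordered_group null_quot_separated).
exists (separated_almost_archimedean null_quot_separated).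
exists null_proj => B.
exists (@AArchHom _ (AArchObj _ _ _) B (null_quot_lift B) (@null_lift_proj B)).
move=> g q /=; have [x <-] := null_proj_surj q.
by rewrite null_lift_proj; exact: (aarch_hom_comm g).
Qed.

End NullQuotient.

(** * Uniqueness of initial objects *)

Section InitialObjects.
Variable X : pog.

Lemma aarch_id_comm (A : aarch_obj X) :
  pos_hom_id (aarch_pog A) \o aarch_map A =1 aarch_map A.
Proof. by []. Qed.

Definition aarch_id (A : aarch_obj X) : aarch_hom A A :=
  AArchHom (@aarch_id_comm A).

Lemma aarch_comp_comm (A B C : aarch_obj X)
    (g : aarch_hom B C) (f : aarch_hom A B) :
  pos_hom_comp g f \o aarch_map A =1 aarch_map C.
Proof.
move=> x /=; rewrite -(aarch_hom_comm g) /=; congr (g _).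
exact: (aarch_hom_comm f).
Qed.

Definition aarch_comp (A B C : aarch_obj X)
    (g : aarch_hom B C) (f : aarch_hom A B) : aarch_hom A C :=
  AArchHom (aarch_comp_comm g f).

Lemma initial_endo_id (A : aarch_obj X) (f : aarch_hom A A) :
  initial A -> f =1 id.
Proof.
by move=> /(_ A)[h uniq_h] x; rewrite uniq_h -(uniq_h (aarch_id A)).
Qed.

Lemma initial_order_isomorphic (A B : aarch_obj X) :
  initial A -> initial B -> order_isomorphic (aarch_pog A) (aarch_pog B).
Proof.
move=> initA initB; have [f _] := initA B; have [g _] := initB A.
exists f, g; split=> x.
  exact: (initial_endo_id (aarch_comp g f) initA).
exact: (initial_endo_id (aarch_comp f g) initB).
Qed.

End InitialObjects.

Theorem theorem5p1 (X : pog) :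
  (exists Y : pog, almost_archimedeanization X Y) /\
  (forall Y1 Y2 : pog,
     almost_archimedeanization X Y1 -> almost_archimedeanization X Y2 ->
     order_isomorphic Y1 Y2).
Proof.
split; first by exists (null_quot X); exact: null_quot_almost_archimedeanization.
move=> Y1 Y2 [o1 [a1 [phi1 init1]]] [o2 [a2 [phi2 init2]]].
exact: (initial_order_isomorphic init1 init2).
Qed.
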